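(* Let $d\geqslant 2$ be an even integer and $e$ an indeterminate. Let $n$ be a positive integer with $n\equiv d+1\pmod{2d}$. Then \[ \sum_{k=0}^{(dn+n-1)/(2d)} [3dk+1] \frac{(q,e,q^{1+d}/e; q^{2d})_{k}\,(q,q,q^{d-1};q^{d})_{k}} {(q^{d},e,q^{1+d}/e;q^{d})_{k}\,(q^{2d},q^{2d},q^{d+2};q^{2d})_{k}}\,q^{dk}\equiv 0 \pmod{\Phi_{n}(q)^3}. \]
   Context: For an indeterminate (or expression) $x$ and a base $p$, $(x;p)_k=(1-x)(1-xp)\cdots(1-xp^{k-1})$ (with $(x;p)_0=1$), and $(x_1,\dots,x_m;p)_k=(x_1;p)_k\cdots(x_m;p)_k$. The $q$-integer is $[n]=(1-q^n)/(1-q)$. $\Phi_n(q)$ denotes the $n$-th cyclotomic polynomial in $q$. Two rational functions $A$ and $B$ (here in $q$ and the extra indeterminate $e$) are congruent modulo a polynomial $P(q)$ if $P(q)$ divides the numerator of the reduced form of $A-B$ in the corresponding polynomial ring with integer coefficients (the denominators being coprime to $P(q)$). *)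

(* Defs.v *)
From mathcomp Require Import all_boot all_order all_algebra all_field.

Set Implicit Arguments.
Unset Strict Implicit.
Unset Printing Implicit Defensive.

Import GRing.Theory.
Local Open Scope ring_scope.

Section Divisibility.
Variable R : idomainType.

(* Not the polynomial relation [%|] of polydiv: over a coefficient ring that
   is not a field, that one is pseudo-divisibility, i.e. it ignores factors
   from the coefficient ring. *)
Definition divides (a b : R) : Prop := exists c, b = c * a.

(* The absence of common non-unit factors; in Z[q, e] this is weaker than the
   existence of a Bezout relation. *)
Definition no_common_factor (a b : R) : Prop :=
  forall c, divides c a -> divides c b -> c \is a GRing.unit.

Definition reduced_form (f : {fraction R}) (a b : R) : Prop :=
  [/\ b != 0, f = tofrac a / tofrac b & no_common_factor a b].

End Divisibility.

(* Z[q, e] is represented as Z[q][e], so that a polynomial in q is a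
   constant of the outer polynomial ring. *)
Definition Zqe : idomainType := {poly {poly int}}.

Definition Qqe : fieldType := {fraction Zqe}.

Definition qvar : Qqe := tofrac ('X%:P : Zqe).

Definition evar : Qqe := tofrac ('X : Zqe).

Definition congr_mod (P : {poly int}) (A B : Qqe) : Prop :=
  exists a b : Zqe,
    [/\ reduced_form (A - B) a b,
        divides P%:P a &
        no_common_factor P%:P b].

Section QNotation.
Variable F : fieldType.

Definition qpoch1 (x p : F) (k : nat) : F := \prod_(i < k) (1 - x * p ^+ i).

Definition qpoch (xs : seq F) (p : F) (k : nat) : F :=
  \prod_(x <- xs) qpoch1 x p k.

Definition qint (q : F) (n : nat) : F := (1 - q ^+ n) / (1 - q).

End QNotation.

(* Main.v *)
Require Import Defs.
From mathcomp Require Import all_boot all_order all_algebra all_field.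
From mathcomp Require Import ring zify.
From Stdlib Require Import Classical.

(** Write p = q^d and n = 2dj + d + 1.  The sum is a truncation of the
    Gasper-Rahman quadratic sum in base p with parameters a = q and b = c = q.
    Deform it to b = q x, c = q / x; as a function of x it is a polynomial in
    s = x + 1 / x, after clearing denominators.

    The terminating Gasper-Rahman sum with a parameter p^-N vanishes for N odd:
    it is a polynomial of degree at most N in b + c, and N + 1 zeros are known,
    namely (N + 1) / 2 at which every term vanishes, (N - 1) / 2 at which the
    sum reduces to a shorter one of the same kind, and one at which it is
    Gasper's telescoping bibasic sum.

    Hence the deformed sum vanishes identically at a primitive n-th root of
    unity, so that Phi_n divides it coefficientwise, and it vanishes for
    generic q at x = q^n.  Between x = 1 and x = q^n the value of q^n s changes
    by (1 - q^n)^2, a multiple of Phi_n^2; so the value at x = 1 is divisible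
    by Phi_n^3. *)

Set Implicit Arguments.
Unset Strict Implicit.
Unset Printing Implicit Defensive.

Import GRing.Theory.
Local Open Scope ring_scope.

(** * Hypergeometric sums with cleared denominators *)

Section ClearedSum.
Variable R : comNzRingType.
Implicit Types (h u v : nat -> R) (M N : nat).

(** The sum of h k times the product of u i / v i over i < k, multiplied by the common denominator;
    this form makes sense in any commutative ring and commutes with ring morphisms. *)
Definition csum M h u v : R :=
  \sum_(k < M.+1) h k * (\prod_(i < k) u i) * \prod_(k <= i < M) v i.

Lemma csum0 h u v : csum 0 h u v = h 0.
Proof. by rewrite /csum big_ord_recl !big_ord0 big_geq // addr0 !mulr1. Qed.

Lemma csumS M h u v :
  csum M.+1 h u v = v M * csum M h u v + h M.+1 * \prod_(i < M.+1) u i.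
Proof.
rewrite /csum big_ord_recr /= (big_geq (leqnn _)) mulr1; congr (_ + _).
rewrite big_distrr; apply: eq_bigr => -[k /= lekM] _.
by rewrite big_nat_recr //=; ring.
Qed.

Lemma eq_csum M h h' u u' v v' :
  (forall i, h i = h' i) -> (forall i, u i = u' i) -> (forall i, v i = v' i) ->
  csum M h u v = csum M h' u' v'.
Proof.
move=> eqh equ eqv; apply: eq_bigr => k _; rewrite eqh.
by congr (_ * _ * _); apply: eq_bigr.
Qed.

(** Terms of index beyond N contain the factor [u N]; the remaining ones share all [v i] with N <= i
    < M. *)
Lemma csum_trunc M N h u v : (N <= M)%N -> u N = 0 ->
  csum M h u v = csum N h u v * \prod_(N <= i < M) v i.
Proof.
move=> /subnKC <- uN0; elim: (M - N)%N => [|k IHk].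
  by rewrite addn0 big_geq ?mulr1.
rewrite addnS csumS IHk big_nat_recr ?leq_addr //=.
have lt_N : (N < (N + k).+1)%N by lia.
rewrite [X in h _ * X](bigD1 (Ordinal lt_N)) //= uN0 mul0r mulr0 addr0.
by rewrite mulrC mulrA.
Qed.

Lemma csumZ M c h u v :
  csum M h (fun i => c * u i) (fun i => c * v i) = c ^+ M * csum M h u v.
Proof.
elim: M => [|M IHM]; first by rewrite !csum0 expr0 mul1r.
rewrite !csumS IHM exprS big_split /= prodr_const card_ord exprS.
ring.
Qed.

Lemma csum_scaleh M c h u v :
  csum M (fun i => c * h i) u v = c * csum M h u v.
Proof.
elim: M => [|M IHM]; first by rewrite !csum0.
by rewrite !csumS IHM; ring.
Qed.

End ClearedSum.

Lemma rmorph_csum (R S : comNzRingType) (f : {rmorphism R -> S}) M h u v :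
  f (csum M h u v) = csum M (f \o h) (f \o u) (f \o v).
Proof.
elim: M => [|M IHM]; first by rewrite !csum0.
by rewrite !csumS rmorphD !rmorphM IHM rmorph_prod.
Qed.

Lemma size_csum (R : idomainType) M (h u v : nat -> {poly R}) :
  (forall i, size (h i) <= 1)%N -> (forall i, size (u i) <= 2)%N ->
  (forall i, size (v i) <= 2)%N -> (size (csum M h u v) <= M.+1)%N.
Proof.
move=> sh su sv.
have szM (a b : {poly R}) k l : (size a <= k.+1 -> size b <= l.+1 ->
    size (a * b)%R <= (k + l).+1)%N.
  by move=> sa sb; apply: leq_trans (size_polyMleq _ _) _; lia.
elim: M => [|M IHM]; first by rewrite csum0.
rewrite csumS; apply: leq_trans (size_polyD _ _) _; rewrite geq_max.
apply/andP; split; first exact: (szM _ _ 1%N M).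
apply: (szM _ _ 0%N M.+1) => //.
elim: (M.+1) => [|k IHk]; first by rewrite big_ord0 size_poly1.
by rewrite big_ord_recr /= -addn1; apply: szM.
Qed.

(** * The Gasper-Rahman quadratic sum and its zeros as a function of b + c *)

Section QuadraticSum.
Variable R : comNzRingType.
Implicit Types p al e y P K : R.

(* The factors of the term ratio of the Gasper-Rahman quadratic sum with
   parameters a = 1/al, b, c, d = 1/P in base p, where bcd = ap, y = al (b + c)
   and K = p^i. *)
Definition qh al K := al - K ^+ 3.
Definition qn p al e y P K :=
  (al - K ^+ 2) * (1 - e * K ^+ 2) * (al * e - p * K ^+ 2)
  * (al - y * K + p * P * K ^+ 2) * (P - K) * p.
Definition qD p al e y P K :=
  (1 - p * K) * (1 - e * K) * (al * e - p * K)
  * (al * P - p * y * K ^+ 2 + p ^+ 3 * K ^+ 4) * (al - p ^+ 2 * P * K ^+ 2).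
Definition qsum M p al e y P :=
  csum M (fun i => qh al (p ^+ i)) (fun i => qn p al e y P (p ^+ i))
    (fun i => qD p al e y P (p ^+ i)).

End QuadraticSum.

Lemma rmorph_qsum (R S : comNzRingType) (f : {rmorphism R -> S}) M p al e y P :
  f (qsum M p al e y P) = qsum M (f p) (f al) (f e) (f y) (f P).
Proof.
rewrite /qsum rmorph_csum; apply: eq_csum => i /=.
- by rewrite /qh rmorphB !rmorphXn.
- by rewrite /qn !(rmorphM, rmorphB, rmorphD, rmorphXn, rmorph1).
- by rewrite /qD !(rmorphM, rmorphB, rmorphD, rmorphXn, rmorph1).
Qed.

Section QuadraticSumRoots.
Variable F : fieldType.
Implicit Types p al e y b P K : F.

(** This is y = al (b + c) in terms of b alone, as bcd = ap gives al c = p P / b. *)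
Definition qy p al P b := al * b + p * P / b.

(* Gasper's bibasic summation, in bases p^2 and p. *)
Lemma qsum_telescope m p al e P : p != 0 -> e != 0 ->
  qsum m p al e (qy p al P (e * p)) P =
  (al - 1) * \prod_(i < m)
    ((al - p ^+ 2 * (p ^+ i) ^+ 2) * (1 - e * p ^+ 2 * (p ^+ i) ^+ 2)
     * (P - p * p ^+ i) * (al * e - p * P * p ^+ i) * (1 - e * p ^+ i)
     * (al * e - p * (p ^+ i) ^+ 2) / e).
Proof.
move=> p0 e0; set y := qy _ _ _ _; rewrite /qsum.
pose W i := (al - p ^+ 2 * (p ^+ i) ^+ 2) * (1 - e * p ^+ 2 * (p ^+ i) ^+ 2)
     * (P - p * p ^+ i) * (al * e - p * P * p ^+ i) * (1 - e * p ^+ i)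
     * (al * e - p * (p ^+ i) ^+ 2) / e.
(* Up to boundary factors, the numerators multiply to the product of [W] that also makes up the
   partial sums; what is left of the induction step is a rational identity in K = p^m. *)
have prod_n k : \prod_(i < k.+1) qn p al e y P (p ^+ i) =
    (al - 1) * (P - 1) * (al * e - P) * (1 - e * p ^+ k) * (1 - e * p * p ^+ k)
    * (al * e - p * (p ^+ k) ^+ 2) * p * p ^+ k / e * \prod_(i < k) W i.
  elim: k => [|k IHk].
    rewrite big_ord_recl !big_ord0 /= !mulr1 expr0 /y /qn /qy.
    by field; rewrite e0.
  rewrite big_ord_recr IHk [in RHS]big_ord_recr /=.
  move: (\prod_(i < k) _) => V; rewrite /y /qn /qy /W (exprS p k).
  by move: (p ^+ k) => K; field; rewrite e0 p0.
elim: m => [|m IHm]; first by rewrite csum0 big_ord0 /qh expr0 expr1n mulr1.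
rewrite csumS IHm prod_n [in RHS]big_ord_recr /= -/(W _).
move: (\prod_(i < m) _) => V; rewrite /qD /y /qy /qh /W (exprS p m).
by move: (p ^+ m) => K; field; rewrite e0 p0.
Qed.

(** The map from b to y is two-to-one: it only identifies b with its partner c. *)
Lemma qy_eq p al P b b' : b != 0 -> b' != 0 ->
  qy p al P b = qy p al P b' -> b = b' \/ al * b * b' = p * P.
Proof.
move=> b0 b'0 /eqP; rewrite -subr_eq0 /qy.
have -> : al * b + p * P / b - (al * b' + p * P / b')
    = (b - b') * (al * b * b' - p * P) / (b * b') by field; rewrite b0 b'0.
rewrite mulf_eq0 invr_eq0 !mulf_eq0 (negPf b0) (negPf b'0) !orbF.
by case/orP; rewrite subr_eq0 => /eqP; [left|right].
Qed.

(** Here c = p^(N+1-2i), so the numerator factor 1 - c K vanishes at index 2i-N-1 and kills all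
    later terms. A denominator factor vanishes at index i-1, which lies between 2i-N-1 and N-1; the
    earlier terms still carry it and vanish too. *)
Lemma qsum_root_al N i p al e : p != 0 -> al != 0 -> (i <= N)%N ->
  (N.+1 <= i.*2)%N ->
  qsum N p al e (qy p al (p ^+ N) (p ^+ i.*2 / al)) (p ^+ N) = 0.
Proof.
move=> p0 al0 iN Ni; rewrite /qsum.
rewrite (@csum_trunc _ N (i.*2 - N.+1)); last 2 first.
- by lia.
- rewrite /qn /qy invf_div; set K := p ^+ (_ - _).
  have pK : p ^+ i.*2 = p * p ^+ N * K by rewrite /K -exprS -exprD subnKC.
  have K0 : K != 0 by rewrite expf_neq0.
  have PN0 : p ^+ N != 0 by rewrite expf_neq0.
  rewrite pK; set A := (X in _ * X * _ * _).
  suff -> : A = 0 by rewrite mulr0 !mul0r.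
  by rewrite /A; field; rewrite K0 PN0 p0 al0.
have ti : (i.*2 - N.+1 <= i.-1 < N)%N by lia.
suff -> : \prod_(i.*2 - N.+1 <= j < N) qD p al e (qy p al (p ^+ N)
    (p ^+ i.*2 / al)) (p ^+ N) (p ^+ j) = 0 by rewrite mulr0.
rewrite (bigD1_seq i.-1) ?iota_uniq ?mem_index_iota //=.
set A := qD _ _ _ _ _ _; suff -> : A = 0 by rewrite mul0r.
rewrite /A /qD /qy invf_div; set K := p ^+ i.-1.
have pK : p ^+ i.*2 = p ^+ 2 * K ^+ 2.
  by rewrite /K -exprM -exprD; congr (_ ^+ _); lia.
rewrite pK; set B := (X in _ * X * _).
suff -> : B = 0 by rewrite mulr0 mul0r.
by rewrite /B /K; field; rewrite expf_neq0 ?p0 ?al0.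
Qed.

(** The parameters b = p^-m and 1/P = p^-N play symmetric roles. The first one stops the sum at m,
    and exchanging them gives the shorter sum, up to the normalising ratio [c] of the two values of
    P. *)
Lemma qsum_root_p N m p al e : p != 0 -> (m <= N)%N ->
  qsum m p al e (qy p al (p ^+ m) (p ^- N)) (p ^+ m) = 0 ->
  qsum N p al e (qy p al (p ^+ N) (p ^- m)) (p ^+ N) = 0.
Proof.
move=> p0 lemN qm0; rewrite /qsum (@csum_trunc _ N m) //; last first.
  rewrite /qn /qy; have : p ^+ m != 0 by rewrite expf_neq0.
  move: (p ^+ m) => K K0.
  set A := (X in _ * X * _ * _).
  suff -> : A = 0 by rewrite mulr0 !mul0r.
  by rewrite /A; field; rewrite K0 oner_neq0.
have Pm0 : p ^+ m != 0 by rewrite expf_neq0.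
have PN0 : p ^+ N != 0 by rewrite expf_neq0.
pose c := p ^+ N / p ^+ m; pose y := qy p al (p ^+ m) (p ^- N).
rewrite (@eq_csum _ m _ (fun i => qh al (p ^+ i))
  _ (fun i => c * qn p al e y (p ^+ m) (p ^+ i))
  _ (fun i => c * qD p al e y (p ^+ m) (p ^+ i))) //.
- by rewrite csumZ -/(qsum m p al e y (p ^+ m)) qm0 mulr0 mul0r.
all: rewrite {}/y {}/c => i.
- rewrite /qn /qy; move: (p ^+ m) (p ^+ N) (p ^+ i) Pm0 PN0 => Pm PN K Pm0 PN0.
  by field; rewrite Pm0 PN0 oner_neq0.
rewrite /qD /qy; move: (p ^+ m) (p ^+ N) (p ^+ i) Pm0 PN0 => Pm PN K Pm0 PN0.
by field; rewrite Pm0 PN0 oner_neq0.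
Qed.

End QuadraticSumRoots.

(** In [qn] and in [qD] a single factor involves y, and it is affine in y. *)
Lemma size_qsum_poly (R : idomainType) N (p al e P : R) :
  (size (qsum N p%:P al%:P e%:P 'X P%:P) <= N.+1)%N.
Proof.
have size_aff (a b : R) : (size (b%:P * 'X + a%:P)%R <= 2)%N.
  by rewrite size_MXaddC; case: ifP => // _; rewrite ltnS size_polyC_leq1.
apply: size_csum => i; rewrite -polyC_exp; move: (p ^+ i) => K.
- by rewrite /qh -polyC_exp -polyCB size_polyC_leq1.
- pose A := (al - K ^+ 2) * (1 - e * K ^+ 2) * (al * e - p * K ^+ 2)
    * (P - K) * p.
  suff -> : qn p%:P al%:P e%:P 'X P%:P K%:P
      = (- (A * K))%:P * 'X + (A * (al + p * P * K ^+ 2))%:P by [].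
  rewrite /A /qn !(polyCM, polyCB, polyCD, polyCN, polyC_exp, polyC1); ring.
pose A := (1 - p * K) * (1 - e * K) * (al * e - p * K)
  * (al - p ^+ 2 * P * K ^+ 2).
suff -> : qD p%:P al%:P e%:P 'X P%:P K%:P
    = (- (A * p * K ^+ 2))%:P * 'X + (A * (al * P + p ^+ 3 * K ^+ 4))%:P by [].
rewrite /A /qD !(polyCM, polyCB, polyCD, polyCN, polyC_exp, polyC1); ring.
Qed.

(** * Vanishing for odd N at generic parameters *)

Section GenericQuadraticSum.
Variables (F : fieldType) (p al e : F).
Hypotheses (p0 : p != 0) (al0 : al != 0) (e0 : e != 0).
Hypothesis p_inj : injective (fun i => p ^+ i).
Hypothesis al_gen : forall i j, al * p ^+ i <> p ^+ j.
Hypothesis e_gen : forall i j, e * p ^+ i <> p ^+ j.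
Hypothesis ale_gen : forall i j, al * e * p ^+ i <> p ^+ j.

Let p_neq0 k : p ^+ k != 0. Proof. exact: expf_neq0. Qed.

(** The N + 1 = 2r + 2 values of b that yield zeros in y: r + 1 with all terms zero, r that reduce
    to a sum of smaller odd length 2t + 1, and the telescoping one. *)
Let bs r := [seq p ^+ (r.+1 + t).*2 / al | t <- iota 0 r.+1]
  ++ [seq p ^- t.*2.+1 | t <- iota 0 r] ++ [:: e * p].

Let bsP r b : b \in bs r ->
  [\/ exists2 t, (t <= r)%N & b = p ^+ (r.+1 + t).*2 / al,
      exists2 t, (t < r)%N & b = p ^- t.*2.+1 | b = e * p].
Proof.
rewrite /bs !mem_cat => /or3P[/mapP[t] | /mapP[t] |].
- by rewrite mem_iota => tr ->; constructor 1; exists t => //; lia.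
- by rewrite mem_iota => tr ->; constructor 2; exists t => //; lia.
by rewrite inE => /eqP ->; constructor 3.
Qed.

Let bs_neq0 r b : b \in bs r -> b != 0.
Proof.
case/bsP => [[t _ ->]|[t _ ->]|->]; rewrite ?invr_neq0 //;
  by rewrite mulf_neq0 ?invr_neq0.
Qed.

Let uniq_bs r : uniq (bs r).
Proof.
rewrite /bs !cat_uniq andbT; apply/and4P; split.
- rewrite map_inj_uniq ?iota_uniq // => i j /(mulIf (invr_neq0 al0)) /p_inj; lia.
- apply/hasPn => b; rewrite mem_cat => /orP[/mapP[j _ ->]|].
    apply/mapP => -[i _] /(congr1 (fun x => x * al * p ^+ j.*2.+1)).
    rewrite divfK // mulrAC mulVf // mul1r -exprD.
    by rewrite -[al in LHS]mulr1 -(expr0 p); apply: al_gen.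
  rewrite inE => /eqP->; apply/mapP => -[i _] /(congr1 (fun x => al * x)).
  by rewrite [RHS]mulrC divfK // mulrA -[X in _ * X = _]expr1; apply: ale_gen.
- rewrite map_inj_uniq ?iota_uniq // => i j /invr_inj /p_inj; lia.
apply/hasPn => b; rewrite inE => /eqP->; apply/mapP => -[i _].
move/(congr1 (fun x => x * p ^+ i.*2.+1)); rewrite mulVf // -mulrA -exprS.
by rewrite -(expr0 p); apply: e_gen.
Qed.

(** Parity settles the mixed case p^(2(r+1+t)) / al against p^-(2t+1); any other coincidence
    contradicts the genericity of al, e or al e. By [qy_eq], the values of y are then distinct. *)
Let bs_conj r b b' : b \in bs r -> b' \in bs r -> b != b' ->
  al * b * b' <> p * p ^+ r.*2.+1.
Proof.
have al2 A B C : al * (p ^+ A / al) * (p ^+ B / al) = p ^+ C -> False.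
  rewrite [al * _]mulrC divfK // => /(congr1 (fun x => x * al)).
  by rewrite mulrA divfK // -exprD mulrC => /esym /al_gen.
have al_p A B C : al * (p ^+ A / al) * p ^- B = p ^+ C -> A = (C + B)%N.
  move/(congr1 (fun x => x * p ^+ B)).
  by rewrite mulfVK // [al * _]mulrC divfK // -exprD => /p_inj.
have al_e A C : al * (p ^+ A / al) * (e * p) = p ^+ C -> False.
  rewrite [al * _]mulrC divfK // mulrCA -exprSr; exact: e_gen.
have p_p A B C : al * p ^- A * p ^- B = p ^+ C -> False.
  move/(congr1 (fun x => x * p ^+ B * p ^+ A)).
  by rewrite !mulfVK // -!exprD -[X in X = _]mulr1 -(expr0 p); apply: al_gen.
have p_e A C : al * p ^- A * (e * p) = p ^+ C -> False.
  move/(congr1 (fun x => x * p ^+ A)).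
  by rewrite mulrAC mulfVK // mulrA -exprD -[X in _ * X]expr1; apply: ale_gen.
move=> bsb bsb' /eqP neq; rewrite -exprS => eq1.
have eq2 : al * b' * b = p ^+ r.*2.+2 by rewrite mulrAC.
case/bsP: bsb neq eq1 eq2 => [[t tr ->]|[t tr ->]|->];
  case/bsP: bsb' => [[t' tr' ->]|[t' tr' ->]|->] neq eq1 eq2 //.
- exact: al2 eq1.
- by move/al_p: eq1; lia.
- exact: al_e eq1.
- by move/al_p: eq2; lia.
- exact: p_p eq1.
- exact: p_e eq1.
- exact: al_e eq2.
exact: p_e eq2.
Qed.

Lemma qsum_odd_generic r y : qsum r.*2.+1 p al e y (p ^+ r.*2.+1) = 0.
Proof.
elim/ltn_ind: r y => r IHr y; set N := r.*2.+1.
pose Q := qsum N p%:P al%:P e%:P 'X (p ^+ N)%:P.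
have QE z : Q.[z] = qsum N p al e z (p ^+ N).
  rewrite -[LHS]/(horner_eval z Q) rmorph_qsum /= /horner_eval.
  by rewrite !(hornerC, hornerX).
suff Q0 : Q = 0 by rewrite -QE Q0 horner0.
pose rs := map (qy p al (p ^+ N)) (bs r).
apply: (@roots_geq_poly_eq0 _ _ rs).
- apply/allP => _ /mapP[b bsb ->]; rewrite rootE QE.
  case/bsP: bsb => [[t tr ->]|[t tr ->]|->].
  + by rewrite qsum_root_al // /N; lia.
  + by rewrite qsum_root_p ?IHr // /N; lia.
  (* The last factor of the closed form contains P - p p^(2r), which is zero for P = p^N. *)
  rewrite qsum_telescope // /N big_ord_recr /= -(exprS p r.*2) subrr.
  by rewrite !(mulr0, mul0r).
- rewrite map_inj_in_uniq ?uniq_bs // => b b' sb sb' /qy_eq.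
  case; rewrite ?(@bs_neq0 r) // => bb'.
  by apply/eqP/negP => /negP ne; apply: (bs_conj sb sb').
apply: leq_trans (size_qsum_poly _ _ _ _ _) _.
by rewrite size_map !size_cat !size_map !size_iota /= /N; lia.
Qed.

End GenericQuadraticSum.

(** * Specialisation from a generic point *)

Lemma XaddC_neq0 (A : nzRingType) (c : A) : 'X + c%:P != 0.
Proof. by rewrite -size_poly_eq0 size_XaddC. Qed.

Lemma tofrac_inj (A : idomainType) : injective (@tofrac A).
Proof. by move=> a b /eqP; rewrite tofrac_eq => /eqP. Qed.

Section GenericPoint.
Variable R : idomainType.
Implicit Types a p al e y : R.

Local Notation S := {poly {poly R}}.
(** The inner variable perturbs the base p, the outer one perturbs the other parameters; setting
    both to 0 recovers arbitrary values in R from generic ones. *)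
Definition at0 : {rmorphism S -> R} := horner_eval 0 \o horner_eval 0.
Definition shift a : S := 'X + a%:P%:P.
Definition base a : S := ('X + a%:P)%:P.

Lemma at0_shift a : at0 (shift a) = a.
Proof. by rewrite /at0 /= /horner_eval !hornerE. Qed.

Lemma at0_base a : at0 (base a) = a.
Proof. by rewrite /at0 /= /horner_eval !hornerE. Qed.

Lemma base_inj p : injective (fun i => base p ^+ i).
Proof.
move=> i j; rewrite -!polyC_exp => /polyC_inj.
move/(congr1 (fun s : {poly R} => size s)).
by rewrite -[p]opprK polyCN !size_exp_XsubC => -[].
Qed.

Lemma base_neq0 p : base p != 0.
Proof. by rewrite polyC_eq0 XaddC_neq0. Qed.

Lemma coef1_shift a (c c' : {poly R}) : (shift a * c%:P + c'%:P)`_1 = c.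
Proof. by rewrite /shift coefD coefMC coefD coefX !coefC /= !addr0 mul1r. Qed.

(** The outer variable has a nonzero coefficient on the left and does not occur on the right. *)
Lemma shift_gen a p i j : shift a * base p ^+ i <> base p ^+ j.
Proof.
move/eqP; rewrite -subr_eq0 -!polyC_exp -polyCN => /eqP.
move/(congr1 (fun s : {poly {poly R}} => s`_1)).
rewrite coef1_shift coef0 => /eqP.
by rewrite expf_eq0 (negPf (XaddC_neq0 _)) andbF.
Qed.

Lemma at0_qsum M (p al e y P : {poly {poly R}}) :
  at0 (qsum M p al e y P) = qsum M (at0 p) (at0 al) (at0 e) (at0 y) (at0 P).
Proof. exact: rmorph_qsum. Qed.

End GenericPoint.

Lemma qsum_odd (R : idomainType) r (p al e y : R) :
  qsum r.*2.+1 p al e y (p ^+ r.*2.+1) = 0.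
Proof.
have shift_neq0 a : shift a != 0 by rewrite XaddC_neq0.
suff q0 : qsum r.*2.+1 (base p) (shift al) (shift e) (shift y)
    (base p ^+ r.*2.+1) = 0.
  have := congr1 (@at0 R) q0.
  by rewrite at0_qsum rmorphXn at0_base !at0_shift rmorph0.
apply: tofrac_inj; rewrite rmorph_qsum rmorphXn rmorph0.
apply: qsum_odd_generic; rewrite ?tofrac_eq0 ?base_neq0 ?shift_neq0 //.
- by move=> i j; rewrite -!tofracXn => /tofrac_inj/base_inj.
- by move=> i j; rewrite -!tofracXn -tofracM => /tofrac_inj/shift_gen.
- by move=> i j; rewrite -!tofracXn -tofracM => /tofrac_inj/shift_gen.
(* For al e, the degrees in the outer variable are compared: 2 on the left, 0 on the right. *)
move=> i j; rewrite -!tofracXn -!tofracM => /tofrac_inj.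
move/(congr1 (fun s : {poly {poly R}} => size s)).
rewrite /shift -!polyC_exp !(mulrC _ (_ ^+ i)%:P) size_Cmul; last first.
  by rewrite expf_neq0 // XaddC_neq0.
rewrite -[al%:P]opprK -[e%:P]opprK !(polyCN (- _)).
rewrite size_Mmonic ?polyXsubC_eq0 ?monicXsubC // !size_XsubC size_polyC.
by rewrite expf_neq0 // XaddC_neq0.
Qed.

(** For al = p^(2M) the numerator factor al - K^2 vanishes at index M, so the sums of length M and N
    = 2r + 1 differ only by a product of denominators. If N > M this product has to be cancelled,
    hence the return to a generic point, where none of its factors is zero. *)
Lemma qsum_even_power (R : idomainType) M r (p e y : R) :
  qsum M p (p ^+ M.*2) e y (p ^+ r.*2.+1) = 0.
Proof.
set N := r.*2.+1.
suff q0 : qsum M (base p) (base p ^+ M.*2) (shift e) (shift y)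
    (base p ^+ N) = 0.
  have := congr1 (@at0 R) q0.
  by rewrite at0_qsum !rmorphXn at0_base !at0_shift rmorph0.
have := qsum_odd r (base p) (base p ^+ M.*2) (shift e) (shift y).
rewrite -/N /qsum; have [leNM|ltMN] := leqP N M => qN0.
  by rewrite (@csum_trunc _ M N) ?qN0 ?mul0r // /qn subrr mulr0 mul0r.
move: qN0; rewrite (@csum_trunc _ N M) ?(ltnW ltMN) //; last first.
  by rewrite /qn -exprM muln2 subrr !mul0r.
move/eqP; rewrite mulf_eq0 => /orP[/eqP //|]; rewrite prodf_seq_eq0.
case/hasP => i; rewrite mem_index_iota => /andP[leMi ltiN] /= /eqP.
have base_expn0 k : ('X + p%:P) ^+ k != 0 :> {poly R}.
  by rewrite expf_neq0 // XaddC_neq0.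
rewrite /qD => /eqP; rewrite !mulf_eq0 => D0; exfalso; move: D0.
case/orP => [/orP[/orP[/orP[]|]|]|].
- by rewrite subr_eq0 -exprS -(expr0 (base p)) => /eqP/base_inj.
- by rewrite subr_eq0 -(expr0 (base p)) eq_sym => /eqP/shift_gen.
- by rewrite subr_eq0 -exprS mulrC => /eqP/shift_gen.
- set b : {poly R} := 'X + p%:P.
  have -> : base p ^+ M.*2 * base p ^+ N
      - base p * shift y * base p ^+ i ^+ 2 + base p ^+ 3 * base p ^+ i ^+ 4
    = shift y * (- (b * (b ^+ i) ^+ 2))%:P
      + (b ^+ M.*2 * b ^+ N + b ^+ 3 * (b ^+ i) ^+ 4)%:P.
    by rewrite /base -/b !(polyCD, polyCN, polyCM, polyC_exp); ring.
  move/eqP/(congr1 (fun s : {poly {poly R}} => s`_1)).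
  rewrite coef1_shift coef0 => /eqP.
  by rewrite oppr_eq0 -exprM -exprS (negPf (base_expn0 _)).
rewrite -exprM -!exprD subr_eq0 => /eqP/base_inj; rewrite /N; lia.
Qed.

(** * The deformed sum, for generic q and at roots of unity *)

Section PaperSum.
Variable R : comNzRingType.
Implicit Types q e s t K : R.

(* The factors for a = q, b = q x and c = q / x in base q^d, where
   s / t = x + 1 / x; the sum of the theorem has s = 2 and t = 1. *)
Definition fh q K := 1 - q * K ^+ 3.
Definition fn d q e s t K :=
  (1 - q * K ^+ 2) * (1 - e * K ^+ 2) * (e - q * q ^+ d * K ^+ 2)
  * (t - q * s * K + q ^+ 2 * t * K ^+ 2) * (1 - q ^+ d.-1 * K) * q ^+ d.
Definition fD d q e s t K :=
  (1 - q ^+ d * K) * (1 - e * K) * (e - q * q ^+ d * K)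
  * (t - (q ^+ d) ^+ 2 * s * K ^+ 2 + (q ^+ d) ^+ 4 * t * K ^+ 4)
  * (1 - q ^+ d * q ^+ 2 * K ^+ 2).
Definition fsum d M q e s t :=
  csum M (fun i => fh q ((q ^+ d) ^+ i)) (fun i => fn d q e s t ((q ^+ d) ^+ i))
    (fun i => fD d q e s t ((q ^+ d) ^+ i)).

Lemma csum_prop M c c' (h h' u u' v v' : nat -> R) :
  (forall i, h i = c * h' i) -> (forall i, u i = c' * u' i) ->
  (forall i, v i = c' * v' i) -> csum M h u v = c * c' ^+ M * csum M h' u' v'.
Proof.
move=> eqh equ eqv; rewrite -mulrA -csumZ -csum_scaleh.
exact: eq_csum.
Qed.

(** [fn] and [fD] are homogeneous of degree 1 in s and t, and each term has M such factors. *)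
Lemma fsumZ d M q e s t c :
  fsum d M q e (c * s) (c * t) = c ^+ M * fsum d M q e s t.
Proof.
rewrite -[c ^+ M]mul1r; apply: csum_prop => i; first by rewrite mul1r.
  by rewrite /fn; ring.
by rewrite /fD; ring.
Qed.

End PaperSum.

Lemma rmorph_fD (R S : comNzRingType) (f : {rmorphism R -> S}) d q e s t K :
  f (fD d q e s t K) = fD d (f q) (f e) (f s) (f t) (f K).
Proof. by rewrite /fD !(rmorphM, rmorphB, rmorphD, rmorphXn, rmorph1). Qed.

Lemma rmorph_fsum (R S : comNzRingType) (f : {rmorphism R -> S}) d M q e s t :
  f (fsum d M q e s t) = fsum d M (f q) (f e) (f s) (f t).
Proof.
rewrite /fsum rmorph_csum; apply: eq_csum => i /=.
- by rewrite /fh !(rmorphB, rmorphM, rmorphXn, rmorph1).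
- by rewrite /fn !(rmorphM, rmorphB, rmorphD, rmorphXn, rmorph1).
- by rewrite rmorph_fD !rmorphXn.
Qed.

(** This is x = q^n, where c = q^(1-n) = p^-N stops the sum at N. With c as the terminating
    parameter, the free pair is q^(n+1) and q^(d-1), whence y = (q^(n+1) + q^(d-1)) / q. *)
Lemma fsum_power (F : fieldType) d M j n (q e : F) :
  q != 0 -> (1 < d)%N -> (j.*2.+1 <= M)%N -> n = (d * j.*2.+1).+1 ->
  fsum d M q e (1 + q ^+ n ^+ 2) (q ^+ n) = 0.
Proof.
move=> q0 d1 leM nE; set N := j.*2.+1; set p := q ^+ d.
have qnE : q ^+ n = q * p ^+ N by rewrite nE exprS exprM.
have pd : q ^+ d.-1 = p / q by rewrite /p -{2}(ltn_predK d1) exprSr mulfK.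
rewrite /fsum (@csum_trunc _ M N) //; last first.
  rewrite /fn -/p qnE; set P := p ^+ N; set A := (X in _ * X * _ * _).
  by suff -> : A = 0 by [rewrite mulr0 !mul0r]; rewrite /A; ring.
set y := q ^+ n + q ^+ d / q ^+ 2.
rewrite (@csum_prop _ N q (q ^+ 4) _ (fun i => qh q^-1 (p ^+ i))
  _ (fun i => qn p q^-1 e y (p ^+ N) (p ^+ i))
  _ (fun i => qD p q^-1 e y (p ^+ N) (p ^+ i))).
- by rewrite -/(qsum N p q^-1 e y (p ^+ N)) qsum_odd mulr0 mul0r.
- by move=> i; rewrite /fh /qh -/p; move: (p ^+ i) => K; field.
- move=> i; rewrite /fn /qn /y pd -/p qnE.
  by move: (p ^+ N) (p ^+ i) => P K; move: (p) => p1; field.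
move=> i; rewrite /fD /qD /y -/p qnE.
by move: (p ^+ N) (p ^+ i) => P K; move: (p) => p1; field.
Qed.

(** The two relations say that al = 1/z is p^(2M) and that P = 1/z^(d-1) is an odd power of p, as
    [qsum_even_power] requires. *)
Lemma fsum_unity (R : idomainType) d M r (z e s : R) : (0 < d)%N ->
  z * (z ^+ d) ^+ M.*2 = 1 -> z ^+ d.-1 * (z ^+ d) ^+ r.*2.+1 = 1 ->
  fsum d M z e s 1 = 0.
Proof.
move=> d0; set p := z ^+ d; set al := p ^+ M.*2; set P := p ^+ r.*2.+1.
set Q := z ^+ d.-1 => zal QP.
have pE : p = z * Q by rewrite /p /Q -exprS prednK.
have pP : p * P = z by rewrite pE -mulrA QP mulr1.
have E2 K c : 1 - z * K ^+ c = z * (al - K ^+ c) by rewrite mulrBr zal.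
have E3 K : e - z * p * K = z * (al * e - p * K).
  by rewrite mulrBr !mulrA zal mul1r.
rewrite /fsum (@csum_prop _ M z (z ^+ 2 * p) _ (fun i => qh al (p ^+ i))
  _ (fun i => qn p al e s P (p ^+ i)) _ (fun i => qD p al e s P (p ^+ i))).
- by rewrite -/(qsum M p al e s P) qsum_even_power mulr0.
- by move=> i; rewrite /fh E2.
- move=> i; rewrite /fn -/p -/Q; move: (p ^+ i) => K.
  have -> : 1 - Q * K = Q * (P - K) by rewrite mulrBr QP.
  have -> : 1 - z * s * K + z ^+ 2 * 1 * K ^+ 2
      = z * (al - s * K + p * P * K ^+ 2) by rewrite mulrDr mulrBr zal pP; ring.
  by rewrite E2 E3 /qn pE; ring.
move=> i; rewrite /fD -/p; move: (p ^+ i) => K.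
have -> : 1 - p * z ^+ 2 * K ^+ 2 = z * (al - p ^+ 2 * P * K ^+ 2).
  have -> : p ^+ 2 * P * K ^+ 2 = p * (p * P) * K ^+ 2 by ring.
  by rewrite mulrBr zal pP; ring.
have -> : 1 - p ^+ 2 * s * K ^+ 2 + p ^+ 4 * 1 * K ^+ 4
    = p * (al * P - p * s * K ^+ 2 + p ^+ 3 * K ^+ 4).
  rewrite mulrDr mulrBr; have -> : p * (al * P) = 1 by rewrite mulrCA pP mulrC.
  by ring.
by rewrite E3 /qD; ring.
Qed.

(** * Powers of a prime element, given as generator of a kernel *)

Section PrimeKernel.
Variables (R S : idomainType) (f : {rmorphism R -> S}) (phi : R).
Hypothesis kerP : forall a, f a = 0 <-> divides phi a.
Hypothesis phi0 : phi != 0.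

Lemma divides_expM k a b : f a != 0 ->
  divides (phi ^+ k) (a * b) -> divides (phi ^+ k) b.
Proof.
move=> fa0; elim: k b => [|k IHk] b [c eq_ab]; first by exists b; rewrite mulr1.
have /kerP[b' eq_b] : f b = 0.
  have /kerP/eqP : divides phi (a * b).
    by exists (c * phi ^+ k); rewrite eq_ab exprSr mulrA.
  by rewrite rmorphM mulf_eq0 (negPf fa0) => /eqP.
have [c' eq_b'] : divides (phi ^+ k) b'.
  apply: IHk; exists c; apply: (mulIf phi0).
  by rewrite -!mulrA -eq_b eq_ab exprSr.
by exists c'; rewrite eq_b eq_b' exprSr mulrA.
Qed.

(** A common factor c is not killed by f. Writing phi^k = c' c, all of phi^k must divide c', so c is
    invertible. *)
Lemma no_common_factor_exp k b : f b != 0 -> no_common_factor (phi ^+ k) b.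
Proof.
move=> fb0 c [c' eqc] [c'' eqb].
have fc0 : f c != 0.
  by apply: contraNneq fb0 => fc; rewrite eqb rmorphM fc mulr0.
have [|x eqx] := @divides_expM k c c' fc0.
  by exists 1; rewrite mulrC -eqc mul1r.
apply/unitrPr; exists x; apply: (mulIf (expf_neq0 k phi0)).
by rewrite mul1r -mulrA -eqx mulrC.
Qed.

End PrimeKernel.

Lemma map_poly_kernel (R S : idomainType) (f : {rmorphism R -> S}) (phi : R) :
  (forall a, f a = 0 -> exists c, a = c * phi) ->
  forall A : {poly R}, map_poly f A = 0 -> exists C, A = C * phi%:P.
Proof.
move=> kerf; elim/poly_ind => [|A c IHA]; first by exists 0; rewrite mul0r.
rewrite rmorphD rmorphM /= map_polyX map_polyC => eq0.
have fc0 : f c = 0.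
  by have := congr1 (fun p : {poly S} => p`_0) eq0; rewrite !coefE /= add0r.
have [|C ->] := IHA.
  apply/polyP => i; have := congr1 (fun p : {poly S} => p`_i.+1) eq0.
  by rewrite coefD coefMX coefC /= addr0 !coef0.
have [c' ->] := kerf c fc0.
by exists (C * 'X + c'%:P); rewrite polyCM mulrDl mulrAC.
Qed.

(** * Existence of reduced forms *)

Section Reduction.
Variables (R : idomainType) (mu : R -> nat).
Hypothesis mu_lt : forall b c : R, c * b != 0 -> c \isn't a GRing.unit ->
  (mu b < mu (c * b))%N.

(** Cancelling a common non-unit factor lowers [mu] of the denominator, so the process ends; the
    total factor cancelled is recorded as c. *)
Lemma reduced_formP (a b : R) : b != 0 -> exists c a' b',
  [/\ a = c * a', b = c * b' & reduced_form (tofrac a / tofrac b) a' b'].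
Proof.
elim: {b}_.+1 {-2}b (ltnSn (mu b)) a => // m IHm b ltbm a b0.
have [ncf|] := classic (no_common_factor a b).
  by exists 1, a, b; rewrite !mul1r.
rewrite /no_common_factor => /not_all_ex_not[c ncf].
have [[a' eqa] {}ncf] := imply_to_and _ _ ncf.
have [[b' eqb] cU] := imply_to_and _ _ ncf.
rewrite mulrC in eqa; rewrite mulrC in eqb.
have cb0 : c * b' != 0 by rewrite -eqb.
have ltb'm : (mu b' < m)%N.
  have := mu_lt cb0 (introT negP cU); rewrite -eqb => lt_mu.
  exact: leq_trans lt_mu ltbm.
have b'0 : b' != 0 by apply: contraNneq b0 => b'0; rewrite eqb b'0 mulr0.
have [c' [a'' [b'' [eqa' eqb' red]]]] := IHm b' ltb'm a' b'0.
exists (c * c'), a'', b''; split.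
- by rewrite eqa eqa'; ring.
- by rewrite eqb eqb'; ring.
suff -> : tofrac a / tofrac b = tofrac a' / tofrac b' by [].
rewrite eqa eqb !tofracM -mulf_div divff ?mul1r // tofrac_eq0.
by move: cb0; rewrite mulf_eq0 => /norP[].
Qed.

End Reduction.

(** None of the three summands decreases under multiplication by a nonzero polynomial, and all of
    them stay the same only if that polynomial is 1 or -1. *)
Definition Zqe_measure (b : {poly {poly int}}) : nat :=
  size b + size (lead_coef b) + `|lead_coef (lead_coef b)|%N.

Lemma Zqe_measure_lt (b c : {poly {poly int}}) :
  c * b != 0 -> c \isn't a GRing.unit ->
  (Zqe_measure b < Zqe_measure (c * b))%N.
Proof.
rewrite mulf_eq0 => /norP[c0 b0] cU.
have lc0 : lead_coef c != 0 by rewrite lead_coef_eq0.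
have lb0 : lead_coef b != 0 by rewrite lead_coef_eq0.
rewrite /Zqe_measure !lead_coefM !size_mul // abszM.
have : (0 < `|lead_coef (lead_coef b)|)%N by rewrite absz_gt0 lead_coef_eq0.
have : (0 < `|lead_coef (lead_coef c)|)%N by rewrite absz_gt0 lead_coef_eq0.
move: (size_poly_gt0 c) (size_poly_gt0 (lead_coef c)).
rewrite c0 lc0 => sc slc k0 l0.
rewrite ltnNge; apply: contra cU => le_mu.
have /andP[/andP[/eqP s1 /eqP s2] /eqP s3] :
    (size c == 1%N) && (size (lead_coef c) == 1%N)
    && (`|lead_coef (lead_coef c)|%N == 1%N).
  move: le_mu sc slc k0 l0.
  move: (size c) (size b) (size (lead_coef c)) (size (lead_coef b)).
  move: `|lead_coef (lead_coef c)|%N `|lead_coef (lead_coef b)|%N => k l x1 x2 x3 x4.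
  move=> le_mu sc slc k0 l0; have [k1|k2] := leqP k 1.
    by have k1' : k = 1%N by [lia]; rewrite k1' in le_mu *; lia.
  by have : (2 * l <= k * l)%N by [rewrite leq_mul2r k2 orbT]; lia.
rewrite poly_unitE s1 eqxx /=.
have -> : c`_0 = lead_coef c by rewrite lead_coefE s1.
rewrite poly_unitE s2 eqxx /=.
have -> : (lead_coef c)`_0 = lead_coef (lead_coef c).
  by rewrite [RHS]lead_coefE s2.
by case: (lead_coef (lead_coef c)) s3 => [k /= ->|[]].
Qed.

(** * Divisibility by cyclotomic polynomials *)

Lemma Cyclotomic_dvd n (z : algC) (P : {poly int}) : n.-primitive_root z ->
  (map_poly intr P).[z] = 0 -> exists c, P = c * 'Phi_n.
Proof.
move=> prim_z Pz0.
pose r := Pdiv.Ring.rmodp P 'Phi_n; pose c := Pdiv.Ring.rdivp P 'Phi_n.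
have eqP' : P = c * 'Phi_n + r.
  exact: Pdiv.RingMonic.rdivp_eq (Cyclotomic_monic n) P.
have Phiz0 : (map_poly intr 'Phi_n).[z] = 0.
  by apply/rootP; rewrite (Cintr_Cyclotomic prim_z) root_cyclotomic.
have rz0 : (map_poly intr r).[z] = 0.
  move: Pz0; rewrite {1}eqP' rmorphD rmorphM /= hornerD hornerM Phiz0 mulr0.
  by rewrite add0r.
(* A nonzero remainder would vanish at z with degree below that of Phi_n, which is the degree of the
   minimal polynomial of z over the rationals. *)
suff r0 : r = 0 by exists c; rewrite {1}eqP' r0 addr0.
apply: contraTeq (isT) => nz_r.
have [p [eq_p _] dvdp] := minCpolyP z.
pose rq : {poly rat} := map_poly intr r.
have size_rq : size rq = size r by apply: size_map_inj_poly; [apply: intr_inj|].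
have : p %| rq.
  rewrite -dvdp; apply/rootP; rewrite -[RHS]rz0; congr (_.[z]).
  by rewrite -map_poly_comp; apply: eq_map_poly => x /=; rewrite rmorph_int.
move/dvdp_leq; rewrite -size_poly_eq0 size_rq size_poly_eq0 => /(_ nz_r).
have -> : size p = size 'Phi_n.
  transitivity (size (map_poly (ratr : rat -> algC) p)).
    by rewrite size_map_poly.
  rewrite -eq_p (minCpoly_cyclotomic prim_z).
  by rewrite size_cyclotomic size_Cyclotomic.
by rewrite leqNgt Pdiv.Ring.ltn_rmodpN0 // monic_neq0 // Cyclotomic_monic.
Qed.

(** * Divisibility of the cleared sum by the cube of Phi_n *)

Section RootOfUnity.
Variables (d j n M : nat) (z : algC).
Hypotheses (d2 : (2 <= d)%N) (d_even : ~~ odd d).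
Hypothesis nE : n = (2 * d * j + d + 1)%N.
Hypothesis ME : M = (d./2 + 1 + j * (d + 1))%N.
Hypothesis prim_z : n.-primitive_root z.

Let dE : d = (d./2).*2.
Proof. by rewrite -[LHS]odd_double_half (negPf d_even). Qed.

Let atz : {rmorphism {poly int} -> algC} :=
  horner_eval z \o map_poly (intr : int -> algC).
Let atz1 : {rmorphism {poly {poly int}} -> {poly algC}} := map_poly atz.
Let atz2 : {rmorphism {poly {poly {poly int}}} -> {poly {poly algC}}} :=
  map_poly atz1.

Let atzX : atz 'X = z.
Proof. by rewrite /atz /= /horner_eval map_polyX hornerX. Qed.

Let atz1q : atz1 ('X%:P) = z%:P.
Proof. by rewrite /atz1 /= map_polyC; congr (_%:P); exact: atzX. Qed.

Let Phi_neq0 : 'Phi_n != 0. Proof. exact/monic_neq0/Cyclotomic_monic. Qed.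

Let atz_Phi : atz 'Phi_n = 0.
Proof.
suff : (map_poly intr 'Phi_n).[z] = 0 by [].
by apply/rootP; rewrite (Cintr_Cyclotomic prim_z) root_cyclotomic.
Qed.

Let ker_atz P : atz P = 0 -> exists c, P = c * 'Phi_n.
Proof. exact: Cyclotomic_dvd. Qed.

Let ker_atz1 A : atz1 A = 0 <-> divides ('Phi_n)%:P A.
Proof.
split=> [|[C ->]]; first exact: (map_poly_kernel ker_atz).
by rewrite rmorphM /= [X in _ * X]map_polyC /= [X in _ * X%:P]atz_Phi mulr0.
Qed.

Let ker_atz2 A : atz2 A = 0 -> exists C, A = C * ('Phi_n)%:P%:P.
Proof. by apply: map_poly_kernel => a /ker_atz1. Qed.

Let atz2C A : atz2 A%:P = (atz1 A)%:P.
Proof. exact: map_polyC. Qed.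

Let q : {poly {poly int}} := 'X%:P.
Let S := fsum d M q 'X 2 1.

Lemma divides_fsum : divides (('Phi_n)%:P ^+ 3) S.
Proof.
(* The new variable is v = q^n (x + 1/x - 2): v = 0 means x = 1, and v = (1 - q^n)^2 means x =
   q^n. *)
pose g := fsum d M q%:P 'X%:P ((2 * q ^+ n)%:P + 'X) (q ^+ n)%:P.
have zn := prim_expr_order prim_z.
have z_expM k : z ^+ (k * n) = 1 by rewrite mulnC exprM zn expr1n.
have [g1 gE] : exists C, g = C * ('Phi_n)%:P%:P.
  apply: ker_atz2; rewrite /g rmorph_fsum.
  have -> : atz2 q%:P = z%:P%:P by rewrite atz2C atz1q.
  have -> : atz2 (q ^+ n)%:P = 1.
    by rewrite atz2C rmorphXn atz1q -polyC_exp zn.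
  (* This r solves d - 1 + d (2r + 1) = (d - 1) n; similarly 2dM + 1 = (d + 1) n. *)
  apply: (@fsum_unity _ _ _ ((d - 1) * j + d./2 - 1)); first by lia.
    rewrite -!polyC_exp -!polyCM -exprM -exprS.
    suff -> : (d * M.*2).+1 = ((d + 1) * n)%N by rewrite z_expM.
    by rewrite ME nE; move: (d./2) dE => h ->; lia.
  rewrite -!polyC_exp -!polyCM -exprM -exprD.
  suff -> : (d.-1 + d * ((d - 1) * j + d./2 - 1).*2.+1 = (d - 1) * n)%N.
    by rewrite z_expM.
  rewrite nE; move: (d./2) dE d2 => [|k] -> // _.
  by rewrite doubleS !subn1 /= [(_ + k.+1)%N]addnS /=; lia.
pose u := (1 - q ^+ n) ^+ 2.
have gv v : g.[v] = fsum d M q 'X (2 * q ^+ n + v) (q ^+ n).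
  rewrite -[LHS]/(horner_eval v g) rmorph_fsum /= /horner_eval.
  by rewrite hornerD !hornerC hornerX.
have g1u : g1.[u] = 0.
  apply: (@mulIf _ (('Phi_n)%:P)); first by rewrite polyC_eq0.
  rewrite mul0r -[LHS](_ : g.[u] = _); last by rewrite gE hornerM hornerC.
  rewrite gv; apply: tofrac_inj; rewrite rmorph_fsum rmorph0 rmorphXn.
  have -> : 2 * q ^+ n + u = 1 + (q ^+ n) ^+ 2 by rewrite /u; ring.
  rewrite rmorphD rmorph1 !rmorphXn; apply: (@fsum_power _ _ _ j).
  - by rewrite tofrac_eq0 polyC_eq0 polyX_eq0.
  - by [].
  - have : (j * 2 <= j * (d + 1))%N by rewrite leq_mul2l; lia.
    by rewrite ME; lia.
  by rewrite nE; lia.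
have [w uE] : exists w, u = w * ('Phi_n)%:P ^+ 2.
  have /ker_atz1[w wE] : atz1 (1 - q ^+ n) = 0.
    by rewrite rmorphB rmorph1 rmorphXn atz1q -polyC_exp zn subrr.
  by exists (w ^+ 2); rewrite /u wE exprMn.
(* Thus g = h (v - u) Phi_n, and at v = 0 the factor u contributes Phi_n^2. *)
have /factor_theorem[h hE] : root g1 u by apply/rootP.
(* By homogeneity g(0) is q^(nM) times S; the power of q becomes 1 at z and can be cancelled. *)
have qnz : atz1 (q ^+ n ^+ M) != 0.
  by rewrite !rmorphXn atz1q -!polyC_exp zn expr1n oner_neq0.
apply: (divides_expM ker_atz1 _ qnz); first by rewrite polyC_eq0.
rewrite -fsumZ mulr1; exists (- h.[0] * w).
have := gv 0; rewrite addr0 [_ * 2]mulrC => <-.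
rewrite gE hE !hornerM hornerXsubC hornerC uE; ring.
Qed.

Lemma fD_eq i : fD d q 'X 2 1 ((q ^+ d) ^+ i) =
  (1 - q ^+ (d * i.+1)) * (1 - 'X * q ^+ (d * i)) * ('X - q ^+ (d * i.+1).+1)
  * (1 - q ^+ (2 * d * i.+1)) ^+ 2 * (1 - q ^+ (2 * d * i + d + 2)).
Proof.
have e1 : q ^+ (d * i.+1) = q ^+ d * q ^+ (d * i) by rewrite mulnS exprD.
have e2 : q ^+ (2 * d * i.+1) = (q ^+ (d * i.+1)) ^+ 2.
  by rewrite -exprM; congr (_ ^+ _); lia.
have e3 : q ^+ (2 * d * i + d + 2) = (q ^+ (d * i)) ^+ 2 * q ^+ d * q ^+ 2.
  by rewrite -exprM -!exprD; congr (_ ^+ _); lia.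
rewrite exprS e2 e3 e1 /fD -exprM.
by move: (q ^+ d) (q ^+ (d * i)) => p K; ring.
Qed.

(** As n is coprime to 2d and i + 1 <= M < n, the exponents d (i + 1) and 2d (i + 1) are not
    multiples of n; the factors containing e remain nonzero polynomials in e. *)
Lemma fD_unity_neq0 i : (i < M)%N ->
  atz1 (fD d q 'X 2 1 ((q ^+ d) ^+ i)) != 0.
Proof.
move=> ltiM.
have oneq k : ~~ (n %| k)%N -> atz1 (1 - q ^+ k) != 0.
  rewrite rmorphB rmorph1 rmorphXn atz1q -polyC_exp -polyCB polyC_eq0 subr_eq0.
  by rewrite eq_sym -(prim_order_dvd prim_z).
have atz1X : atz1 'X = 'X by exact: map_polyX.
have neq (P : {poly algC}) k : P`_k != 0 -> P != 0.
  by apply: contraNneq => ->; rewrite coef0.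
have coprime_nd : coprime n (2 * d).
  rewrite coprimeMr coprimen2; apply/andP; split.
    by rewrite nE -mulnA mul2n oddD oddD odd_double /= (negPf d_even).
  rewrite nE; have -> : (2 * d * j + d + 1 = (2 * j + 1) * d + 1)%N by lia.
  by rewrite /coprime gcdnC gcdnMDl gcdn1.
have ltMn : (M < n)%N.
  have : (j * (d + 1) <= j * (2 * d))%N by rewrite leq_mul2l; lia.
  by rewrite ME nE; move: dE; lia.
have n_ndvd : ~~ (n %| i.+1)%N by apply/negP => /dvdn_leq; lia.
rewrite fD_eq rmorphM mulf_neq0 //; last first.
  (* Let 2di + d + 2 = m n. Once m = 0 and m = 1 are excluded, reduction modulo d gives m = 2 + l d.
     Parity forbids l = 0, and l > 0 forces i >= M. *)
  apply: oneq; apply/negP => /dvdnP[m mE].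
  have m_gt1 : (1 < m)%N.
    have d_odd x : (d * x <> 1)%N by move/eqP; rewrite muln_eq1; lia.
    case: m mE => [|[|m]] //; first by lia.
    rewrite nE => mE; exfalso; apply: (d_odd (j.*2 - i.*2)%N).
    by rewrite mulnBr; lia.
  have dvd_m : (d * (m * (2 * j + 1)) + (m - 2) = d * (2 * i + 1))%N.
    by move: mE; rewrite nE; lia.
  have : (d %| m - 2)%N.
    by rewrite -(@dvdn_addr (d * (m * (2 * j + 1)))) ?dvd_m ?dvdn_mulr.
  case/dvdnP => l lE; move: dvd_m; rewrite lE [(l * d)%N]mulnC -mulnDr => /eqP.
  rewrite eqn_pmul2l ?(ltnW d2) // => /eqP ilE.
  have l_gt0 : (0 < l)%N by case: l lE ilE => [|l] //; lia.
  have le_dl : (d <= l * d)%N by rewrite leq_pmull.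
  have : ((d + 2) * (2 * j + 1) <= m * (2 * j + 1))%N by rewrite leq_mul2r; lia.
  by move: ltiM ilE; rewrite ME; move: dE; lia.
rewrite rmorphM mulf_neq0 //; last first.
  by rewrite rmorphXn expf_neq0 // oneq // Gauss_dvdr.
rewrite rmorphM mulf_neq0 //; last first.
  apply: (neq _ 1); rewrite rmorphB rmorphXn atz1X atz1q -polyC_exp.
  by rewrite coefB coefX coefC subr0 oner_neq0.
rewrite rmorphM mulf_neq0 //.
  rewrite oneq // Gauss_dvdr //.
  by move: coprime_nd; rewrite coprimeMr => /andP[].
apply: (neq _ 0); rewrite rmorphB rmorph1 rmorphM rmorphXn atz1X atz1q -polyC_exp.
by rewrite coefB coefMC coefX coef1 mul0r subr0 oner_neq0.
Qed.

Lemma fD_neq0 i : (i < M)%N -> fD d q 'X 2 1 ((q ^+ d) ^+ i) != 0.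
Proof. by move/fD_unity_neq0; apply: contraNneq => ->; rewrite rmorph0. Qed.

(** The factor lost in reduction divides a denominator that is nonzero at z, so Phi_n^3 still
    divides the reduced numerator. *)
Lemma congr_mod_fsum :
  congr_mod ('Phi_n ^+ 3) (tofrac S / tofrac ((1 - q) * \prod_(0 <= i < M)
    fD d q 'X 2 1 ((q ^+ d) ^+ i))) 0.
Proof.
set B := (1 - q) * _; have B_neq0 : atz1 B != 0.
  rewrite rmorphM mulf_neq0 //; last first.
    rewrite rmorph_prod big_mkord; apply/prodf_neq0 => i _.
    exact: fD_unity_neq0.
  rewrite rmorphB rmorph1 atz1q -polyCB polyC_eq0 subr_eq0 eq_sym -(expr1 z).
  by rewrite -(prim_order_dvd prim_z) dvdn1 nE; lia.
have nzB : B != 0 by apply: contraNneq B_neq0 => ->; rewrite rmorph0.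
have [c [a [b [Sca Bcb red]]]] := reduced_formP Zqe_measure_lt S nzB.
move: B_neq0; rewrite Bcb rmorphM mulf_eq0 => /norP[c_neq0 b_neq0].
have nzPhi : ('Phi_n)%:P != 0 :> {poly {poly int}} by rewrite polyC_eq0.
exists a, b; split; first by rewrite -Bcb subr0.
  rewrite polyC_exp; apply: (divides_expM ker_atz1 nzPhi c_neq0).
  by rewrite -Sca; apply: divides_fsum.
by rewrite polyC_exp; apply: (no_common_factor_exp ker_atz1 nzPhi).
Qed.

End RootOfUnity.

(** * Return to q-shifted factorials in the fraction field *)

Lemma rmorph_fD21 (R S : comNzRingType) (f : {rmorphism R -> S}) d q e i :
  f (fD d q e 2 1 ((q ^+ d) ^+ i)) = fD d (f q) (f e) 2 1 ((f q ^+ d) ^+ i).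
Proof. by rewrite rmorph_fD !rmorphXn rmorph1 rmorph_nat. Qed.

Lemma tofrac_quotient (R : idomainType) d M (q e : R) :
  tofrac (fsum d M q e 2 1)
    / tofrac ((1 - q) * \prod_(0 <= i < M) fD d q e 2 1 ((q ^+ d) ^+ i))
  = fsum d M (tofrac q) (tofrac e) 2 1
    / ((1 - tofrac q)
       * \prod_(0 <= i < M) fD d (tofrac q) (tofrac e) 2 1 ((tofrac q ^+ d) ^+ i)).
Proof.
rewrite rmorph_fsum rmorph1 rmorph_nat rmorphM rmorphB rmorph1 rmorph_prod.
by under eq_bigr do rewrite rmorph_fD21.
Qed.

Lemma csum_div (F : fieldType) M (h u v : nat -> F) :
  (forall i, (i < M)%N -> v i != 0) ->
  csum M h u v / \prod_(0 <= i < M) v i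
  = \sum_(0 <= k < M.+1) h k * \prod_(i < k) (u i / v i).
Proof.
elim: M => [|M IHM] nzv.
  by rewrite csum0 big_geq ?big_nat1 ?big_ord0 ?divr1 ?mulr1.
rewrite csumS big_nat_recr //= [RHS]big_nat_recr //= -IHM; last first.
  by move=> i ltiM; apply: nzv; exact: ltnW.
have nzP : \prod_(0 <= i < M) v i != 0.
  rewrite big_mkord; apply/prodf_neq0 => i _; apply: nzv.
  exact: ltnW (ltn_ord i).
have := nzv M (ltnSn M); rewrite prodf_div -[in RHS](big_mkord xpredT v).
rewrite [X in _ + _ * (_ / X)]big_nat_recr //=.
move: (\prod_(0 <= i < M) v i) nzP => V nzV nzvM.
by field; rewrite nzV nzvM.
Qed.

Lemma qpoch3 (F : fieldType) (a b c p : F) k :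
  qpoch [:: a; b; c] p k =
  \prod_(i < k) ((1 - a * p ^+ i) * (1 - b * p ^+ i) * (1 - c * p ^+ i)).
Proof. by rewrite /qpoch !big_cons big_nil mulr1 mulrA -!big_split. Qed.

Lemma qpoch_ratio (F : fieldType) (q e : F) d k : e != 0 ->
  (qpoch [:: q; e; q ^+ (1 + d) / e] (q ^+ (2 * d)) k
    * qpoch [:: q; q; q ^+ (d - 1)] (q ^+ d) k)
  / (qpoch [:: q ^+ d; e; q ^+ (1 + d) / e] (q ^+ d) k
    * qpoch [:: q ^+ (2 * d); q ^+ (2 * d); q ^+ (d + 2)] (q ^+ (2 * d)) k)
  * q ^+ (d * k)
  = \prod_(i < k) (fn d q e 2 1 ((q ^+ d) ^+ i) / fD d q e 2 1 ((q ^+ d) ^+ i)).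
Proof.
move=> e0; have -> : q ^+ (d * k) = \prod_(i < k) q ^+ d.
  by rewrite prodr_const card_ord exprM.
rewrite !qpoch3 -!big_split -prodf_div -big_split /=.
apply: eq_bigr => i _.
rewrite [(2 * d)%N]mulnC exprM exprAC !exprD expr1 subn1 /fn /fD.
move: (q ^+ d) ((q ^+ d) ^+ i) (q ^+ d.-1) => p K Q.
set num := (X in X / _); set den := (X in _ / X * _).
(* The factor e clears the denominator of q^(1+d) / e above and below. *)
transitivity ((e * (num * p)) / (e * den)).
  by rewrite -mulf_div divff // mul1r mulrAC.
congr (_ / _).
  by rewrite /num; field.
by rewrite /den; field.
Qed.

Lemma quadratic_sumE (F : fieldType) (q e : F) d M : e != 0 ->
  (forall i, (i < M)%N -> fD d q e 2 1 ((q ^+ d) ^+ i) != 0) ->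
  \sum_(0 <= k < M.+1)
    qint q (3 * d * k + 1)
    * (qpoch [:: q; e; q ^+ (1 + d) / e] (q ^+ (2 * d)) k
       * qpoch [:: q; q; q ^+ (d - 1)] (q ^+ d) k)
    / (qpoch [:: q ^+ d; e; q ^+ (1 + d) / e] (q ^+ d) k
       * qpoch [:: q ^+ (2 * d); q ^+ (2 * d); q ^+ (d + 2)] (q ^+ (2 * d)) k)
    * q ^+ (d * k)
  = fsum d M q e 2 1
    / ((1 - q) * \prod_(0 <= i < M) fD d q e 2 1 ((q ^+ d) ^+ i)).
Proof.
move=> e0 nzfD; rewrite invfM mulrCA /fsum csum_div // big_distrr /=.
apply: eq_bigr => k _; rewrite -qpoch_ratio // /qint /fh.
have -> : q ^+ (3 * d * k + 1) = q * ((q ^+ d) ^+ k) ^+ 3.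
  by rewrite -!exprM -exprS; congr (_ ^+ _); lia.
by rewrite -!mulrA mulrCA.
Qed.

Theorem theorem1p1 (d n : nat) (hd2 : (2 <= d)%N) (hd : ~~ odd d)
    (hn0 : (0 < n)%N) (hn : (n = d + 1 %[mod 2 * d])%N) :
  let q := qvar in
  let e := evar in
  congr_mod ('Phi_n ^+ 3)
    (\sum_(0 <= k < ((d * n + n - 1) %/ (2 * d)).+1)
       qint q (3 * d * k + 1)
       * (qpoch [:: q; e; q ^+ (1 + d) / e] (q ^+ (2 * d)) k
          * qpoch [:: q; q; q ^+ (d - 1)] (q ^+ d) k)
       / (qpoch [:: q ^+ d; e; q ^+ (1 + d) / e] (q ^+ d) k
          * qpoch [:: q ^+ (2 * d); q ^+ (2 * d); q ^+ (d + 2)] (q ^+ (2 * d)) k)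
       * q ^+ (d * k))
    0.
Proof.
move=> q e; set M := ((d * n + n - 1) %/ (2 * d))%N.
pose j := (n %/ (2 * d))%N.
have nE : n = (2 * d * j + d + 1)%N.
  by rewrite [LHS](divn_eq n (2 * d)) hn modn_small /j; lia.
have dE : d = d./2.*2 by rewrite -[LHS]odd_double_half (negPf hd).
have ME : M = (d./2 + 1 + j * (d + 1))%N.
  (* The division is exact: (d + 1) n - 1 is a multiple of 2d because d is even. *)
  rewrite /M (_ : d * n + n - 1 = (d./2 + 1 + j * (d + 1)) * (2 * d))%N.
    by rewrite mulnK // muln_gt0 (ltnW hd2).
  by rewrite nE; clearbody j; clear -dE; move: (d./2) dE => h ->; lia.
have [z prim_z] := C_prim_root_exists hn0.
have e0 : e != 0 by rewrite tofrac_eq0 polyX_eq0.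
have nzfD i : (i < M)%N -> fD d q e 2 1 ((q ^+ d) ^+ i) != 0.
  move=> ltiM; have := fD_neq0 hd2 hd nE ME prim_z ltiM.
  by rewrite -tofrac_eq0 rmorph_fD21.
rewrite (quadratic_sumE e0 nzfD) -tofrac_quotient.
exact: congr_mod_fsum hd2 hd nE ME prim_z.
Qed.
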